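(* Let $X,Y$ be metric spaces, $X\times Y$ equipped with the maximum metric, let $\Delta$ be a scale and $g,h$ Hausdorff functions. For any set $E\subseteq X\times Y$, $$\mathcal P^{gh}_{\Delta}(E)\ \ge\ \int^*\vec{\mathcal B}^{g}(E_x)\,d\mathcal P^{h}_{\Delta}(x).$$
   Context: In a metric space $(X,d)$: $\operatorname{gap}F=\inf\{d(x,y):x,y\in F,x\neq y\}$, $C_\delta(E)=\sup\{|F|:F\subseteq E,\operatorname{gap}F>\delta\}$. A Hausdorff function is a nondecreasing $g:(0,\infty)\to(0,\infty)$; $gh$ is the pointwise product. A scale is a set $\Delta\subseteq(0,\infty)$ with $0$ in its closure. A packing is a family $\pi=\{(x_i,r_i):i\in I\}\subseteq X\times(0,\infty)$ with $d(x_i,x_j)>r_i$ for all $i\ne j$; it is a packing of $E$ if all $x_i\in E$, $\Delta$-valued if all $r_i\in\Delta$, $\delta$-fine if all $r_i\le\delta$; $g(\pi)=\sum_ig(r_i)$. Define $\mathcal P^g_{\Delta,\delta}(E)=\sup\{g(\pi):\pi$ a $\Delta$-valued $\delta$-fine packing of $E\}$, $\mathcal P^g_{\Delta,0}(E)=\inf_{\delta>0}\mathcal P^g_{\Delta,\delta}(E)$ and $\mathcal P^g_\Delta(E)=\inf\{\sum_n\mathcal P^g_{\Delta,0}(E_n):E\subseteq\bigcup_nE_n\}$ (countable covers); $\mathcal P^h_\Delta$ restricted to Borel sets is a Borel measure. Let $\underline{\mathcal B}^g_0(E)=\liminf_{\delta\to0}C_\delta(E)g(\delta)$ and $\vec{\mathcal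 B}^g(E)=\inf\{\sup_n\underline{\mathcal B}^g_0(E_n):E_n\uparrow E\}$, where $E_n\uparrow E$ means $(E_n)$ is an increasing sequence with union $E$. $E_x=\{y\in Y:(x,y)\in E\}$. The upper integral of $f\colon X\to[0,\infty]$ is $\int^*f\,d\mu=\inf\{\int\varphi\,d\mu:\varphi\ge f\ \text{Borel measurable}\}$. *)

(* Defs.v *)
From HB Require Import structures.
From mathcomp Require Import all_boot all_order all_algebra.
From mathcomp Require Import all_classical all_reals.
From mathcomp Require Import ereal topology normedtype sequences esum measure lebesgue_measure measurable_realfun lebesgue_integral.
Set Implicit Arguments. Unset Strict Implicit. Unset Printing Implicit Defensive.
Import Order.TTheory GRing.Theory Num.Theory.
Import numFieldNormedType.Exports.
Local Open Scope classical_set_scope.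
Local Open Scope ring_scope.

Section Defs.
Variable R : realType.

Definition is_metric (T : Type) (d : T -> T -> R) : Prop :=
  (forall x y, 0 <= d x y) /\
  (forall x y, d x y = 0 <-> x = y) /\
  (forall x y, d x y = d y x) /\
  (forall x y z, d x z <= d x y + d y z).

Definition max_metric (X Y : Type) (dX : X -> X -> R) (dY : Y -> Y -> R) :
  X * Y -> X * Y -> R := fun p q => Num.max (dX p.1 q.1) (dY p.2 q.2).

Definition hausdorff_fun (g : R -> R) : Prop :=
  (forall r, 0 < r -> 0 < g r) /\
  (forall r s, 0 < r -> r <= s -> g r <= g s).

Definition scale (D : set R) : Prop :=
  D `<=` [set r | 0 < r] /\ closure D 0.

(* a packing, represented as the set of its pairs (x_i, r_i) *)
Definition packing (T : Type) (d : T -> T -> R) (P : set (T * R)) : Prop :=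
  (forall p, P p -> 0 < p.2) /\
  (forall p q, P p -> P q -> p <> q -> p.2 < d p.1 q.1).

Definition packing_value (T : choiceType) (g : R -> R) (P : set (T * R)) : \bar R :=
  esum P (fun p => (g p.2)%:E).

Definition Pdelta (T : choiceType) (d : T -> T -> R) (g : R -> R) (D : set R)
    (delta : R) (E : set T) : \bar R :=
  ereal_sup [set packing_value g P | P in
    [set P | packing d P /\ (forall p, P p -> E p.1 /\ D p.2 /\ p.2 <= delta)]].

Definition Pzero (T : choiceType) (d : T -> T -> R) (g : R -> R) (D : set R)
    (E : set T) : \bar R :=
  ereal_inf [set Pdelta d g D delta E | delta in [set delta | 0 < delta]].

Definition Pmeas (T : choiceType) (d : T -> T -> R) (g : R -> R) (D : set R)
    (E : set T) : \bar R :=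
  ereal_inf [set (\sum_(0 <= n <oo) Pzero d g D (F n))%E | F in
    [set F : nat -> set T | E `<=` \bigcup_n F n]].

(* gap F (inf of the empty set is +oo) *)
Definition gap (T : Type) (d : T -> T -> R) (F : set T) : \bar R :=
  ereal_inf [set (d p.1 p.2)%:E | p in [set p : T * T | F p.1 /\ F p.2 /\ p.1 <> p.2]].

Definition ecard (T : choiceType) (F : set T) : \bar R := esum F (fun _ => 1%E).

Definition Cdelta (T : choiceType) (d : T -> T -> R) (delta : R) (E : set T) : \bar R :=
  ereal_sup [set ecard F | F in [set F | F `<=` E /\ (delta%:E < gap d F)%E]].

Definition lowerB0 (T : choiceType) (d : T -> T -> R) (g : R -> R) (E : set T) : \bar R :=
  ereal_sup [set ereal_inf [set (Cdelta d delta E * (g delta)%:E)%E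
                             | delta in [set delta | 0 < delta < eta]]
            | eta in [set eta | 0 < eta]].

Definition vecB (T : choiceType) (d : T -> T -> R) (g : R -> R) (E : set T) : \bar R :=
  ereal_inf [set ereal_sup [set lowerB0 d g (F n) | n in [set: nat]] | F in
    [set F : nat -> set T | (forall n, F n `<=` F n.+1) /\ \bigcup_n F n = E]].

Definition metric_open (T : Type) (d : T -> T -> R) : set (set T) :=
  [set U | forall x, U x -> exists e, 0 < e /\ [set y | d x y < e] `<=` U].

Definition xsection (X Y : Type) (E : set (X * Y)) (x : X) : set Y :=
  [set y | E (x, y)].

Definition upper_integral (dsp : measure_display) (T : measurableType dsp)
    (mu : {measure set T -> \bar R}) (f : T -> \bar R) : \bar R :=
  ereal_inf [set (\int[mu]_x phi x)%E | phi in
    [set phi : T -> \bar R | measurable_fun setT phi /\ (forall x, (f x <= phi x)%E)]].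

End Defs.

Definition borel_metric (R : realType) (X : pointedType) (d : X -> X -> R) :=
  g_sigma_algebraType (metric_open d).

(* Main.v *)
(**
  Let [f_eta x] be the infimum of [C_delta(E_x) g(delta)] over [delta < eta].
  Attaching to each ball [(x_i, r_i)] of a packing of [X] an [r_i]-separated
  subset of the fibre [E_(x_i)] gives a packing of [E], whence
  [sum_i f_eta(x_i) h(r_i) <= P^(gh)_(D,delta)(E)] for [delta < eta].  Because
  packing inequalities are strict, the centres of a finite packing may be moved
  a little, so [f_eta] can be replaced by its upper semicontinuous envelope
  [phi], which is Borel and has closed level sets [{phi >= c}].  Differences of
  consecutive level sets are increasing unions of mutually separated sets, and
  packings of separated sets can be united; continuity of [mu] from below then
  yields [int phi dmu <= P^(gh)_(D,0)(E)].  Monotone convergence for upper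
  integrals, applied first to [eta -> 0] and then to the finite unions of a
  countable cover of [E] (on which [P^(gh)_(D,0)] is subadditive), concludes.
*)

Require Import Defs.
From HB Require Import structures.
From mathcomp Require Import all_boot all_order all_algebra.
From mathcomp Require Import all_classical all_reals.
From mathcomp Require Import ereal topology normedtype sequences esum measure lebesgue_measure measurable_realfun lebesgue_integral.
From mathcomp Require Import numfun.
Import Order.TTheory GRing.Theory Num.Theory.
Local Open Scope classical_set_scope.
Local Open Scope ring_scope.
Set Implicit Arguments. Unset Strict Implicit. Unset Printing Implicit Defensive.

(** * Suprema, infima and sums of extended reals *)

Section ereal_bounds.
Context {R : realType}.
Local Open Scope ereal_scope.
Implicit Types A B : set (\bar R).

(** As [0] lies in both sets, [z] bounds each of them separately; for real [z] this makes finite the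
    terms moved across the inequality. *)
Lemma ereal_supD_le A B z :
  (forall a, A a -> 0 <= a) -> (forall b, B b -> 0 <= b) -> A 0 -> B 0 ->
  (forall a b, A a -> B b -> a + b <= z) -> ereal_sup A + ereal_sup B <= z.
Proof.
move=> A0 B0 A00 B00 ABz.
case: z ABz => [z| |] ABz; last 2 first.
- by rewrite leey.
- by have := ABz _ _ A00 B00; rewrite adde0.
have Afin : ereal_sup A \is a fin_num.
  rewrite ge0_fin_numE; last exact: ereal_sup_ubound.
  apply: (@le_lt_trans _ _ z%:E); last exact: ltry.
  by apply: ge_ereal_sup => a Aa; rewrite -[a]adde0 ABz.
rewrite addeC -leeBrDr//; apply: ge_ereal_sup => b Bb.
have bfin : b \is a fin_num.
  rewrite ge0_fin_numE; last exact: B0.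
  apply: (@le_lt_trans _ _ z%:E); last exact: ltry.
  by rewrite -[b]add0e ABz.
rewrite leeBrDr// addeC -leeBrDr//; apply: ge_ereal_sup => a Aa.
by rewrite leeBrDr// ABz.
Qed.

Lemma ereal_infD_ge A B z :
  (forall a, A a -> 0 <= a) -> (forall b, B b -> 0 <= b) ->
  (forall a b, A a -> B b -> z <= a + b) -> z <= ereal_inf A + ereal_inf B.
Proof.
move=> A0 B0 ABz.
have iA0 : 0 <= ereal_inf A by exact: le_ereal_inf_tmp.
have iB0 : 0 <= ereal_inf B by exact: le_ereal_inf_tmp.
have [->|Ay] := eqVneq (ereal_inf A) +oo.
  by rewrite addye ?leey// gt_eqF// (lt_le_trans _ iB0).
have [->|By] := eqVneq (ereal_inf B) +oo.
  by rewrite addey ?leey// gt_eqF// (lt_le_trans _ iA0).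
have Afin : ereal_inf A \is a fin_num by rewrite ge0_fin_numE// ltey.
have Bfin : ereal_inf B \is a fin_num by rewrite ge0_fin_numE// ltey.
apply/lee_addgt0Pr => e e0.
have e20 : (0 < e / 2)%R by rewrite divr_gt0.
have [a Aa ae] := lb_ereal_inf_adherent e20 Afin.
have [b Bb be] := lb_ereal_inf_adherent e20 Bfin.
apply: (le_trans (ABz _ _ Aa Bb)).
rewrite [e]splitr EFinD addeACA; apply: leeD; exact: ltW.
Qed.

Lemma esumZl (T : choiceType) (I : set T) (a : T -> \bar R) (r : R) :
  (0 <= r)%R -> (forall i, 0 <= a i) ->
  \esum_(i in I) (r%:E * a i) = r%:E * \esum_(i in I) a i.
Proof.
move=> r0 a0; rewrite /esum -ereal_supZl//; last first.
  by apply/set0P; exists (\sum_(x \in set0) a x), set0 => //; exact: fsets_set0.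
congr ereal_sup; rewrite image_comp; apply: eq_imagel => X _ /=.
by rewrite ge0_mule_fsumr.
Qed.

Lemma pos_min_seq (T : eqType) (s : seq T) (u : T -> R) :
  (forall x, x \in s -> (0 < u x)%R) ->
  exists2 e, (0 < e)%R & forall x, x \in s -> (e <= u x)%R.
Proof.
elim: s => [|x s IH] us; first by exists 1%R.
have [|e e0 es] := IH; first by move=> y ys; rewrite us// inE ys orbT.
have ux : (0 < u x)%R by rewrite us// inE eqxx.
exists (Num.min e (u x)); first by rewrite lt_min e0.
move=> y; rewrite inE => /predU1P[->|/es ey]; first by rewrite ge_min lexx orbT.
by rewrite ge_min ey.
Qed.

End ereal_bounds.

(** * Packings weighted by centre and radius *)

Section weighted_packings.
Context {R : realType} {T : choiceType}.
Variables (d : T -> T -> R) (D : set R).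
Implicit Types (A B E : set T) (w : T * R -> R) (delta : R) (P : set (T * R)).

Definition fine_packings delta E : set (set (T * R)) :=
  [set P | packing d P /\ (forall p, P p -> E p.1 /\ D p.2 /\ p.2 <= delta)].

(** [Pdelta] is the case [w p = g p.2], by conversion. A weight that also sees the centre lets a
    step function on the space be summed along a packing. *)
Definition wpack w delta E : \bar R :=
  ereal_sup [set (\esum_(p in P) (w p)%:E)%E | P in fine_packings delta E].

Lemma sub_fine_packings P Q delta delta' A B : P `<=` Q -> delta <= delta' ->
  (forall p, P p -> A p.1 -> B p.1) ->
  fine_packings delta A Q -> fine_packings delta' B P.
Proof.
move=> PQ dd AB [[Q0 Qd] QA]; split; first split.
- by move=> p /PQ /Q0.
- by move=> p q /PQ Qp /PQ; exact: Qd.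
- move=> p Pp; have [Ap [Dp pd]] := QA _ (PQ _ Pp).
  by split; [exact: AB|split => //; exact: le_trans dd].
Qed.

Lemma fine_packings0 delta E : fine_packings delta E set0.
Proof. by []. Qed.

Let wval w delta E := [set (\esum_(p in P) (w p)%:E)%E | P in fine_packings delta E].

Let wval0 w delta E : wval w delta E 0%E.
Proof. by exists set0; [exact: fine_packings0|rewrite esum_set0]. Qed.

Let wval_ge0 w delta E a : (forall p, 0 < p.2 -> 0 <= w p) -> wval w delta E a -> (0 <= a)%E.
Proof.
move=> w0 [P [[P0 _] _] <-]; apply: esum_ge0 => p Pp.
by rewrite lee_fin w0// P0.
Qed.

Lemma wpack_ge0 w delta E : (0 <= wpack w delta E)%E.
Proof. by apply: ereal_sup_ubound; exact: wval0. Qed.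

Lemma le_wpack w delta delta' A B : A `<=` B -> delta <= delta' ->
  (wpack w delta A <= wpack w delta' B)%E.
Proof.
move=> AB dd; apply: ereal_sup_le => _ [P PA <-]; exists P => //.
by apply: sub_fine_packings dd _ PA => // p _; exact: AB.
Qed.

Lemma wpackZl_le w v c delta E : 0 <= c -> (forall p, 0 < p.2 -> 0 <= v p) ->
  (forall p, E p.1 -> 0 < p.2 -> c * v p <= w p) ->
  (c%:E * wpack v delta E <= wpack w delta E)%E.
Proof.
move=> c0 v0 vw; rewrite -ereal_supZl//; last first.
  by apply/set0P; exists 0%E; exact: wval0.
apply: ge_ereal_sup => _ [_ [P PE <-] <-].
apply: le_trans (ereal_sup_ubound _); last by exists P.
(* [esumZl] asks for nonnegative terms at all indices, while [v] is only known to be so at positive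
   radii; truncation at [0] changes nothing on [P]. *)
rewrite [X in (_ * X)%E](_ : _ = \esum_(p in P) (Num.max 0 (v p))%:E)%E; last first.
  apply: eq_esum => p Pp; congr (_%:E); apply/esym/max_r/v0.
  by case: PE => -[/(_ _ Pp)].
rewrite -esumZl//; last by move=> p; rewrite lee_fin le_max lexx.
apply: le_esum => p Pp; case: PE => -[/(_ _ Pp) p0 _] /(_ _ Pp)[Ep _].
by rewrite -EFinM lee_fin max_r ?v0// vw.
Qed.

(** Radii are at most [delta], so centres from the two sets are farther apart than either radius:
    two packings unite, disjointly, into one. *)
Lemma wpack_superadd w delta A B : is_metric d ->
  (forall p, 0 < p.2 -> 0 <= w p) -> (forall x y, A x -> B y -> delta < d x y) ->
  (wpack w delta A + wpack w delta B <= wpack w delta (A `|` B))%E.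
Proof.
move=> [_ [dE [dC _]]] w0 AB; apply: ereal_supD_le;
  [by move=> a; exact: wval_ge0|by move=> a; exact: wval_ge0|exact: wval0|exact: wval0|].
move=> _ _ [P [[P0 Pd] PA] <-] [Q [[Q0 Qd] QB] <-].
have PQ p : P p -> ~ Q p.
  move=> Pp Qp; have [Ap [_ pd]] := PA _ Pp; have [Bp _] := QB _ Qp.
  have := AB _ _ Ap Bp; rewrite (_ : d p.1 p.1 = 0); last exact/dE.
  by apply/negP; rewrite -leNgt (le_trans (ltW (P0 _ Pp))).
apply: le_trans (ereal_sup_ubound _); last first.
  exists (P `|` Q) => //; split; first split.
  - by move=> p [/P0|/Q0].
  - move=> p q [Pp|Qp] [Pq|Qq] pq; [exact: Pd| | |exact: Qd].
    + have [Ap [_ pd]] := PA _ Pp; have [Bq _] := QB _ Qq.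
      by rewrite (le_lt_trans pd)// AB.
    + have [Bp [_ pd]] := QB _ Qp; have [Aq _] := PA _ Pq.
      by rewrite (le_lt_trans pd)// dC AB.
  - by move=> p [/PA[Ap ?]|/QB[Bp ?]]; split => //; [left|right].
rewrite [leRHS](esumID P); last by move=> p [/P0|/Q0] p0; rewrite lee_fin w0.
rewrite (_ : _ `&` P = P); last first.
  by apply/seteqP; split=> p; [case|move=> Pp; split => //; left].
rewrite (_ : _ `&` ~` P = Q)//; apply/seteqP; split=> p.
  by case=> -[].
by move=> Qp; split; [right|move=> Pp; exact: (PQ p)].
Qed.

Lemma wpack_subadd w delta A B : (forall p, 0 < p.2 -> 0 <= w p) ->
  (wpack w delta (A `|` B) <= wpack w delta A + wpack w delta B)%E.
Proof.
move=> w0; apply: ge_ereal_sup => _ [P PAB <-].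
rewrite (esumID [set p | A p.1]); last first.
  by move=> p Pp; case: PAB => -[/(_ _ Pp) p0 _] _; rewrite lee_fin w0.
apply: leeD; apply: ereal_sup_ubound; eexists; [|reflexivity| |reflexivity].
- by apply: sub_fine_packings (@subIsetl _ _ _) (lexx _) _ PAB => p [].
- by apply: sub_fine_packings (@subIsetl _ _ _) (lexx _) _ PAB => p [_ /= ?] [].
Qed.

Lemma wpack_sum_le w delta (B : nat -> set T) n : is_metric d ->
  (forall p, 0 < p.2 -> 0 <= w p) ->
  (forall i j x y, (i < j)%N -> B i x -> B j y -> delta < d x y) ->
  (\sum_(i < n) wpack w delta (B i) <= wpack w delta setT)%E.
Proof.
move=> dm w0 Bd.
suff /le_trans : (\sum_(i < n) wpack w delta (B i) <=
    wpack w delta [set x | exists2 i, (i < n)%N & B i x])%E.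
  by apply; exact: le_wpack.
elim: n => [|n IH]; first by rewrite big_ord0 wpack_ge0.
rewrite big_ord_recr/=; apply: le_trans (leeD2r _ IH) _.
apply: le_trans (wpack_superadd dm w0 _) _.
  by move=> x y [i ni Bx] By; exact: Bd ni Bx By.
apply: le_wpack => // x [[i ni Bx]|Bx]; last by exists n.
by exists i => //; exact: ltnW.
Qed.

End weighted_packings.

(** * The packing premeasure and its countable-cover infimum *)

Section packing_premeasure.
Context {R : realType} {T : choiceType}.
Variables (d : T -> T -> R) (D : set R) (g : R -> R).
Hypothesis g0 : forall r, 0 < r -> 0 <= g r.
Implicit Types A B E : set T.

Lemma Pzero_ge0 E : (0 <= Pzero d g D E)%E.
Proof. by apply: le_ereal_inf_tmp => _ [e e0 <-]; exact: wpack_ge0. Qed.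

Lemma Pzero_set0 : Pzero d g D set0 = 0%E.
Proof.
apply/eqP; rewrite eq_le Pzero_ge0 andbT; apply: ge_ereal_inf.
exists (Pdelta d g D 1 set0); first by exists 1 => //=.
apply: ge_ereal_sup => _ [P [_ PE] <-].
rewrite /packing_value (_ : P = set0) ?esum_set0//.
by rewrite -subset0 => p /PE[].
Qed.

Lemma le_Pzero A B : A `<=` B -> (Pzero d g D A <= Pzero d g D B)%E.
Proof.
move=> AB; apply: le_ereal_inf_tmp => _ [e e0 <-]; apply: ge_ereal_inf.
by exists (Pdelta d g D e A); [exists e|exact: le_wpack].
Qed.

Lemma Pzero_subadd A B :
  (Pzero d g D (A `|` B) <= Pzero d g D A + Pzero d g D B)%E.
Proof.
apply: ereal_infD_ge; [by move=> _ [e _ <-]; exact: wpack_ge0..|].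
move=> _ _ [e1 e10 <-] [e2 e20 <-].
apply: ge_ereal_inf; exists (Pdelta d g D (Num.min e1 e2) (A `|` B)).
  by exists (Num.min e1 e2) => //=; rewrite lt_min e10.
apply: (@le_trans _ _ (wpack d D (fun p => g p.2) (Num.min e1 e2) A
                     + wpack d D (fun p => g p.2) (Num.min e1 e2) B))%E.
  by apply: wpack_subadd => p; exact: g0.
by apply: leeD; apply: le_wpack => //; rewrite ge_min lexx ?orbT.
Qed.

Lemma Pzero_bigcup_lt (F : nat -> set T) n :
  (Pzero d g D [set x | exists2 i, (i < n)%N & F i x]
     <= \sum_(0 <= i < n) Pzero d g D (F i))%E.
Proof.
elim: n => [|n IH].
  by rewrite big_geq// (_ : [set _ | _] = set0) ?Pzero_set0// -subset0 => x [].
rewrite big_nat_recr//=; apply: le_trans (leeD2r _ IH).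
apply: le_trans (Pzero_subadd _ _); apply: le_Pzero => x [i].
by rewrite ltnS leq_eqVlt => /predU1P[->|ni] Fx; [right|left; exists i].
Qed.

Lemma Pmeas_le_Pzero E : (Pmeas d g D E <= Pzero d g D E)%E.
Proof.
pose F n := if n is 0%N then E else set0.
apply: ge_ereal_inf; exists (\sum_(0 <= n <oo) Pzero d g D (F n))%E.
  by exists F => // x Ex; exists 0%N.
rewrite nneseries_recl//; last by move=> *; exact: Pzero_ge0.
rewrite eseries0 ?adde0// => -[|n]//= _ _; exact: Pzero_set0.
Qed.

End packing_premeasure.

(** * Lifting packings from a factor to the product *)

Section product_packing.
Context {R : realType} {X Y : choiceType}.
Variables (dX : X -> X -> R) (dY : Y -> Y -> R) (D : set R) (g h : R -> R).
Variable E : set (X * Y).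
Hypothesis mX : is_metric dX.
Hypotheses (hg : hausdorff_fun g) (hh : hausdorff_fun h).

(* [xsection] is MathComp's (the same set as [Defs.xsection], which it shadows),
   as in the statement of the theorem. *)
Definition lowerB_upto (eta : R) (x : X) : \bar R :=
  ereal_inf [set (Cdelta dY delta (xsection E x) * (g delta)%:E)%E
            | delta in [set delta | 0 < delta < eta]].

(** The upper limit of [f] at [x], the value at [x] included. [lowerB_upto] itself need not be
    Borel; this majorant is. *)
Definition usc_envelope (f : X -> \bar R) (x : X) : \bar R :=
  ereal_inf [set ereal_sup [set f y | y in [set y | dX x y < e]]
            | e in [set e | 0 < e]].

Lemma le_usc_envelope f x : (f x <= usc_envelope f x)%E.
Proof.
apply: le_ereal_inf_tmp => _ [e e0 <-]; apply: ereal_sup_ubound; exists x => //=.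
by case: mX => _ [/(_ x x)[_ ->]].
Qed.

Lemma usc_envelope_lt_near f x c e : 0 < e -> (c < usc_envelope f x)%E ->
  exists2 y, dX x y < e & (c < f y)%E.
Proof.
move=> e0 cf.
have : (c < ereal_sup [set f y | y in [set y | (dX x y < e)%R]])%E.
  by apply: lt_le_trans cf _; apply: ereal_inf_lbound; exists e.
by move=> /ereal_sup_gt[_ [y xy <-] cy]; exists y.
Qed.

Lemma metric_open_usc_envelope f c :
  metric_open dX [set x | (usc_envelope f x < c)%E].
Proof.
case: (mX) => dge0 [dE [dC dT]].
move=> x /= /ereal_inf_lt[_ [e e0 <-] ec].
exists (e / 2); split; first by rewrite divr_gt0.
move=> y /= xy; apply: le_lt_trans ec; apply: ge_ereal_inf.
eexists; first by exists (e / 2) => //=; rewrite divr_gt0.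
apply: ereal_sup_le => _ [z yz <-]; exists z => //=.
by rewrite (le_lt_trans (dT _ y _))// [e]splitr ltrD.
Qed.

Lemma Cdelta_ge0 delta (F : set Y) : (0 <= Cdelta dY delta F)%E.
Proof.
apply: ereal_sup_ubound; exists set0; last by rewrite /ecard esum_set0.
split => //; rewrite /gap (_ : [set _ | _ in _] = set0) ?ereal_inf0 ?ltry//.
by rewrite -subset0 => _ [p [[]]].
Qed.

Lemma le_Cdelta delta (F G : set Y) : F `<=` G ->
  (Cdelta dY delta F <= Cdelta dY delta G)%E.
Proof.
by move=> FG; apply: ereal_sup_le => _ [H [HF gH] <-]; exists H => //; split => // y /HF/FG.
Qed.

Lemma lowerB_upto_ge0 eta x : (0 <= lowerB_upto eta x)%E.
Proof.
apply: le_ereal_inf_tmp => _ [r /andP[r0 _] <-].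
by rewrite mule_ge0 ?Cdelta_ge0// lee_fin ltW//; case: hg => + _; exact.
Qed.

(* Every small ball of the packing carries a separated subset of a nearby
   fibre; the packing inequalities being strict, finitely many centres can be
   moved to those fibres without spoiling the packing. *)
Lemma esum_packing_le (w : X * R -> R) delta eta P :
  delta < eta -> finite_set P -> fine_packings dX D delta setT P ->
  (forall p, P p -> w p = 0 \/ ((w p)%:E < usc_envelope (lowerB_upto eta) p.1)%E) ->
  (\esum_(p in P) (w p * h p.2)%:E <=
     Pdelta (max_metric dX dY) (fun r => (g r * h r)%R) D delta E)%E.
Proof.
case: (mX) => dge0 [dE [dC dT]] de finP [[P0 Pd] PD] wP.
have [g0 _] := hg; have [h0 _] := hh.
(* By finiteness all packing inequalities hold with a common slack [e + e], so both centres of a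
   pair may move by less than [e]. *)
have [e e0 Pe] : exists2 e, 0 < e & forall p q, P p -> P q -> p <> q ->
    p.2 + (e + e) <= dX p.1 q.1.
  have /finite_seqP[s sE] := finite_setX finP finP.
  have sP pq : (pq \in s) <-> P pq.1 /\ P pq.2.
    by have := congr1 (fun A => A pq) sE; rewrite /setX/= => ->.
  have [|e e0 es] := @pos_min_seq R _ [seq pq <- s | pq.1 != pq.2]
      (fun pq => dX pq.1.1 pq.2.1 - pq.1.2).
    move=> pq; rewrite mem_filter => /andP[/eqP npq /sP[Pp Pq]].
    by rewrite subr_gt0 Pd.
  exists (e / 2); first by rewrite divr_gt0.
  move=> p q Pp Pq pq; rewrite -splitr -lerBrDl.
  by apply: (es (p, q)); rewrite mem_filter; apply/andP; split; [exact/eqP|exact/sP].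
have /choice[yF yFP] : forall p, exists yF : X * set Y, P p ->
    [/\ dX p.1 yF.1 < e, yF.2 `<=` xsection E yF.1, (p.2%:E < gap dY yF.2)%E
      & ((w p)%:E <= ecard R yF.2 * (g p.2)%:E)%E].
  move=> p; have [Pp|nPp] := pselect (P p); last by exists (p.1, set0).
  (* At weight zero the centre stays put and carries the empty set, whose gap is [+oo]. *)
  have [w0|] := wP _ Pp.
    exists (p.1, set0) => _; split => //=.
    - by rewrite (_ : dX _ _ = 0)//; exact/dE.
    - rewrite /gap (_ : [set _ | _ in _] = set0) ?ereal_inf0 ?ltry//.
      by rewrite -subset0 => _ [q [[]]].
    - by rewrite w0 /ecard esum_set0 mul0e.
  move=> /(usc_envelope_lt_near e0)[y py wy].
  have p0 := P0 _ Pp; have [_ [_ pd]] := PD _ Pp.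
  (* Since [p.2 <= delta < eta], the radius is itself one of the scales in the infimum defining
     [lowerB_upto eta]. *)
  have : ((w p)%:E < Cdelta dY p.2 (xsection E y) * (g p.2)%:E)%E.
    apply: lt_le_trans wy _; apply: ereal_inf_lbound; exists p.2 => //=.
    by rewrite p0 (le_lt_trans pd).
  rewrite -lte_pdivrMr ?g0// => /ereal_sup_gt[_ [F [FE gF] <-] wF].
  by exists (y, F) => _; split => //=; rewrite -lee_pdivrMr ?g0// ltW.
pose y p := (yF p).1; pose F p := (yF p).2.
have ysep p q : P p -> P q -> p <> q -> p.2 < dX (y p) (y q).
  move=> Pp Pq pq; have [yp _ _ _] := yFP _ Pp; have [yq _ _ _] := yFP _ Pq.
  have h1 := dT p.1 (y p) q.1; have h2 := dT (y p) (y q) q.1.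
  have h3 := Pe _ _ Pp Pq pq.
  rewrite dC in yq; rewrite -(ltrD2r (e + e)) (le_lt_trans h3)//.
  rewrite (le_lt_trans h1)// (le_lt_trans (lerD (lexx _) h2))//.
  by rewrite addrCA ltrD2l ltrD.
have yinj p q : P p -> P q -> y p = y q -> p = q.
  move=> Pp Pq ypq; apply: contrapT => /(ysep _ _ Pp Pq).
  rewrite (_ : dX _ _ = 0); last exact/dE.
  by rewrite ltNge ltW// P0.
(* Each ball of [P] becomes balls of the same radius centred at [(y p, z)] with [z] in [F p]. Those
   over different [p] are separated by [ysep], those over the same [p] by the gap of [F p]. *)
pose b (k : (X * R) * Y) : (X * Y) * R := ((y k.1, k.2), k.1.2).
apply: (@le_trans _ _ (\esum_(q in b @` (P `*`` F)) (g q.2 * h q.2)%:E)%E); last first.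
  apply: ereal_sup_ubound; exists (b @` (P `*`` F)) => //; split; first split.
  - by move=> _ [k [Pk _] <-] /=; exact: P0.
  - move=> _ _ [[p z] [/= Pp Fz] <-] [[q t] [/= Pq Ft] <-] /= bpq.
    rewrite /max_metric/= lt_max.
    have [pq|pq] := pselect (p = q); last by rewrite ysep.
    subst q; apply/orP; right; rewrite -lte_fin.
    have [_ _ gF _] := yFP _ Pp; apply: lt_le_trans gF _.
    apply: ereal_inf_lbound; exists (z, t) => //=; split => //; split => // zt.
    by apply: bpq; rewrite zt.
  - move=> _ [[p z] [/= Pp Fz] <-] /=; have [_ FE _ _] := yFP _ Pp.
    by split; [by have := FE _ Fz; rewrite /xsection/= in_setE|have [_] := PD _ Pp].
(* [b] is injective because the moved centre [y p] determines [p]. *)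
rewrite (@reindex_esum _ _ _ (P `*`` F) _ b); last first.
  split; [by move=> k Pk; exists k| |by []].
  move=> [p z] [q t]; rewrite !in_setE => -[/= Pp _] [/= Pq _] [ypq -> _].
  by rewrite (yinj p q).
rewrite -(@esum_esum _ _ _ P F (fun p _ => (g p.2 * h p.2)%:E)); last first.
  by move=> p z /P0 p0 _; rewrite lee_fin mulr_ge0 ?ltW ?g0 ?h0.
(* The inner sum is [g p.2 * h p.2] times the cardinality of [F p], and [F p] was chosen so that
   this cardinality times [g p.2] is at least [w p]. *)
apply: le_esum => p Pp; have p0 := P0 _ Pp; have [_ _ _ wF] := yFP _ Pp.
rewrite (_ : (fun _ => _) = fun _ => ((g p.2 * h p.2)%:E * 1)%E); last first.
  by apply/funext => z; rewrite mule1.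
rewrite esumZl//; last by rewrite mulr_ge0 ?ltW ?g0 ?h0.
rewrite !EFinM muleC -[leRHS]muleA (muleC (g _)%:E) -muleA.
by apply: lee_wpmul2l => //; rewrite lee_fin ltW ?h0.
Qed.

(** An unordered sum is the supremum of its finite partial sums, so the restriction of
    [esum_packing_le] to finite packings costs nothing. *)
Lemma wpack_le_Pdelta (w : X * R -> R) delta eta : delta < eta ->
  (forall p, 0 < p.2 -> 0 <= w p) ->
  (forall p, w p = 0 \/ ((w p)%:E < usc_envelope (lowerB_upto eta) p.1)%E) ->
  (wpack dX D (fun p => (w p * h p.2)%R) delta setT <=
     Pdelta (max_metric dX dY) (fun r => (g r * h r)%R) D delta E)%E.
Proof.
move=> de w0 wP; apply: ge_ereal_sup => _ [P PD <-].
apply: ge_ereal_sup => _ [Q [finQ QP] <-].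
have QD : fine_packings dX D delta setT Q by exact: sub_fine_packings PD.
rewrite -esum_fset//; last first.
  move=> p; rewrite in_setE => Qp; have p0 : 0 < p.2 by case: QD => -[/(_ _ Qp)].
  by rewrite lee_fin mulr_ge0 ?w0// ltW//; case: hh => + _; exact.
exact: (@esum_packing_le w _ eta).
Qed.

End product_packing.

(** * Integration through dyadic level sets *)

Section dyadic_levels.
Context {R : realType} {dsp : measure_display} {T : measurableType dsp}.
Variable f : T -> \bar R.
Hypothesis f0 : forall x, (0 <= f x)%E.

(** The cut to [set0] beyond [k = n * 2 ^ n] makes the last difference all of [f >= n], matching the
    top term of the simple function [approx]. *)
Definition dyadic_level n k : set T := if (k <= n * 2 ^ n)%N then
  [set x | ((k%:R / 2 ^+ n)%:E <= f x)%E] else set0.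

Lemma dyadic_level_decr n k : dyadic_level n k.+1 `<=` dyadic_level n k.
Proof.
rewrite /dyadic_level; case: ltnP => [kn|_]; last exact: sub0set.
rewrite (ltnW kn) => x /=.
by apply: le_trans; rewrite lee_fin ler_pM2r ?ler_nat// invr_gt0 exprn_gt0.
Qed.

Lemma approx_dyadic_level n x : approx setT f n x =
  \sum_(k < (n * 2 ^ n).+1)
    k%:R / 2 ^+ n * \1_(dyadic_level n k `\` dyadic_level n k.+1) x.
Proof.
rewrite big_ord_recr/= /approx; congr (_ + _); last first.
  rewrite natrM natrX mulfK ?expf_neq0//; congr (_ * \1_(_) x).
  rewrite /integer_approx /dyadic_level leqnn ltnn setTI setD0.
  by rewrite natrM natrX mulfK ?expf_neq0.
apply: eq_bigr => k _; congr (_ * \1_(_) x).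
rewrite /dyadic_approx /dyadic_level ltn_ord (ltnW (ltn_ord k)) setTI.
apply/seteqP; split => y /=; rewrite in_setE /=.
  move=> [r + <-]; rewrite in_itv/= => /andP[kr rk].
  by split; rewrite lee_fin// leNgt rk.
move=> [kf /negP]; rewrite -ltNge => fk; exists (fine (f y)).
  rewrite /dyadic_itv in_itv/= -lee_fin -lte_fin fineK ?kf//.
  by rewrite ge0_fin_numE// (lt_trans fk) ?ltry.
by rewrite fineK// ge0_fin_numE// (lt_trans fk) ?ltry.
Qed.

Hypothesis mf : measurable_fun setT f.

Lemma measurable_dyadic_level n k : measurable (dyadic_level n k).
Proof.
rewrite /dyadic_level; case: ifP => // _.
by rewrite -[X in measurable X]setTI; exact: emeasurable_fun_c_infty.
Qed.

Let mdD n k : measurable (dyadic_level n k `\` dyadic_level n k.+1).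
Proof. by apply: measurableD; exact: measurable_dyadic_level. Qed.

(** Monotone convergence: [f] is the increasing limit of its dyadic approximations, and the sums in
    the hypothesis are their integrals. *)
Lemma integral_le_dyadic_level (mu : {measure set T -> \bar R}) (z : \bar R) :
  (forall n, (\sum_(k < (n * 2 ^ n).+1) (k%:R / 2 ^+ n)%:E *
    mu (dyadic_level n k `\` dyadic_level n k.+1) <= z)%E) ->
  (\int[mu]_x f x <= z)%E.
Proof.
move=> Hz.
have mapp n : measurable_fun setT (EFin \o approx setT f n).
  apply/measurable_EFinP; rewrite (funext (approx_dyadic_level n)).
  by apply: measurable_sum => k; exact: measurable_funM.
have -> : (\int[mu]_x f x = \int[mu]_x limn (fun n => (approx setT f n x)%:E))%E.
  apply: eq_integral => x _; apply/esym/cvg_lim => //.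
  by apply: (@ecvg_approx _ _ _ setT f).
apply: (@cvge_le _ \oo _ _ (fun n => \int[mu]_x (approx setT f n x)%:E)%E); last first.
  apply: cvg_monotone_convergence => //.
  - by move=> n x _; rewrite lee_fin approx_dyadic_level sumr_ge0.
  - by move=> x _ m n mn; rewrite lee_fin; exact/lefP/nd_approx.
apply: nearW => n; apply: le_trans (Hz n); rewrite le_eqVlt; apply/orP; left.
under eq_integral do rewrite approx_dyadic_level -sumEFin.
rewrite ge0_integral_sum//; last first.
- by move=> k; apply/measurable_EFinP; exact: measurable_funM.
- apply/eqP; apply: eq_bigr => k _; under eq_integral do rewrite EFinM.
  rewrite ge0_integralZl_EFin//; last exact/measurable_EFinP.
  by rewrite integral_indic// setIT.
Qed.

End dyadic_levels.

(** * Monotone convergence for upper integrals *)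

Section upper_integrals.
Context {R : realType} {dsp : measure_display} {T : measurableType dsp}.
Variable mu : {measure set T -> \bar R}.
Local Open Scope ereal_scope.

(** A form of [upper_integral mu f <= z] that carries a witness, so that sequences of majorants can
    be chosen without an epsilon. *)
Definition majorized (f : T -> \bar R) (z : \bar R) : Prop :=
  exists phi, [/\ measurable_fun setT phi, forall x, f x <= phi x
                & \int[mu]_x phi x <= z].

Lemma upper_integral_le f z : majorized f z -> upper_integral mu f <= z.
Proof.
move=> [phi [mphi fphi phiz]]; apply: ge_ereal_inf.
by exists (\int[mu]_x phi x) => //; exists phi.
Qed.

Lemma le_majorized f f' z z' : (forall x, f x <= f' x) -> z' <= z ->
  majorized f' z' -> majorized f z.
Proof.
move=> ff zz [phi [mphi fphi phiz]]; exists phi; split => //.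
- by move=> x; exact: le_trans (fphi x).
- exact: le_trans zz.
Qed.

Lemma majorized_sup (f : nat -> T -> \bar R) z :
  (forall n x, 0 <= f n x) -> (forall n m x, (n <= m)%N -> f n x <= f m x) ->
  (forall n, majorized (f n) z) ->
  majorized (fun x => ereal_sup [set f n x | n in setT]) z.
Proof.
move=> f0 nd /choice[phi phiP].
(* The chosen majorants need not be monotone in [n]. The infimum of [phi m] over [m >= n] is, and it
   still lies above [f n] because [f n <= f m <= phi m]. *)
pose psi n x := einfs (phi ^~ x) n.
have mpsi n : measurable_fun setT (psi n).
  by apply: measurable_fun_einfs => m; case: (phiP m).
have fpsi n x : f n x <= psi n x.
  apply: le_ereal_inf_tmp => _ [m /= nm <-]; apply: le_trans (nd _ _ _ nm) _.
  by case: (phiP m).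
have psi0 n x : 0 <= psi n x by exact: le_trans (fpsi n x).
have ndpsi x : {homo psi^~ x : n m / (n <= m)%N >-> n <= m}.
  by move=> n m nm; exact: nondecreasing_einfs.
exists (fun x => limn (psi^~ x)); split.
- apply: emeasurable_fun_cvg mpsi _ => x _.
  exact: ereal_nondecreasing_is_cvgn.
- move=> x; apply: ge_ereal_sup => _ [n _ <-]; apply: le_trans (fpsi n x) _.
  have /cvg_lim -> // := @cvg_einfs_sup R (phi ^~ x).
  by apply: ereal_sup_ubound; exists n.
- apply: (@cvge_le _ \oo _ _ (fun n => \int[mu]_x psi n x)); last first.
    exact: cvg_monotone_convergence.
  apply: nearW => n; have [mphi fphi phiz] := phiP n.
  apply: le_trans phiz; apply: ge0_le_integral => //.
  by move=> x _; apply: ereal_inf_lbound; exists n => /=.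
Qed.

End upper_integrals.

(** * The integral inequality for product sets *)

Section upper_integral_product.
Context {R : realType} {X : pointedType} {Y : choiceType}.
Variables (dX : X -> X -> R) (dY : Y -> Y -> R) (D : set R) (g h : R -> R).
Hypothesis mX : is_metric dX.
Hypotheses (hg : hausdorff_fun g) (hh : hausdorff_fun h).
Variable mu : {measure set (borel_metric dX) -> \bar R}.
Hypothesis muE : forall A : set (borel_metric dX), measurable A ->
  mu A = Pmeas dX h D A.

Let gh r := g r * h r.

Lemma measurable_metric_open (U : set (borel_metric dX)) :
  metric_open dX U -> measurable U.
Proof. exact: sub_sigma_algebra. Qed.

Lemma measurable_usc_envelope (f : X -> \bar R) :
  measurable_fun setT (usc_envelope dX f : borel_metric dX -> \bar R).
Proof.
apply: (measurability _ (ErealGenInftyO.measurableE R)) => _ /= -[_ [r ->] <-].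
rewrite setTI preimage_itvNyo; apply: measurable_metric_open.
exact: metric_open_usc_envelope.
Qed.

(** Stated pointwise, so that an empty [L], as occurs above the last dyadic level, excludes no
    point. *)
Let far (L : set X) (e : R) : set (borel_metric dX) :=
  [set x | forall y, L y -> e <= dX x y].

Let measurable_far L e : measurable (far L e).
Proof.
case: mX => dge0 [dE [dC dT]].
rewrite -[X in measurable X]setCK; apply: measurableC.
apply: measurable_metric_open => x /= /existsNP[y /not_implyP[Ly /negP]].
rewrite -ltNge => xy; exists (e - dX x y); split; first by rewrite subr_gt0.
move=> z /= xz /(_ _ Ly); apply/negP; rewrite -ltNge.
by rewrite (le_lt_trans (dT _ x _))// -ltrBrDr dC.
Qed.

Section level_sets.
Variables (E : set (X * Y)) (eta : R) (w : X -> R) (c : nat -> R).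
Variable (L : nat -> set (borel_metric dX)).
Hypothesis eta0 : 0 < eta.
Hypothesis w0 : forall x, 0 <= w x.
Hypothesis wP : forall x,
  w x = 0 \/ ((w x)%:E < usc_envelope dX (lowerB_upto dY g E eta) x)%E.
Hypothesis c0 : forall j, 0 <= c j.
Hypothesis mL : forall j, measurable (L j).
Hypothesis openLC : forall j, metric_open dX (~` L j).
Hypothesis Ldecr : forall j, L j.+1 `<=` L j.

Let L_le i j : (i <= j)%N -> L j `<=` L i.
Proof.
elim: j => [|j IH]; first by rewrite leqn0 => /eqP ->.
rewrite leq_eqVlt => /predU1P[->//|]; rewrite ltnS => /IH ji.
by apply: subset_trans ji; exact: Ldecr.
Qed.

(* Truncations of the differences [L j `\` L j.+1] that are at mutual
   distance at least [m.+1%:R^-1], so that packings of them can be united. *)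
Let B m j : set (borel_metric dX) := L j `&` far (L j.+1) m.+1%:R^-1.

Let measurable_B m j : measurable (B m j).
Proof. exact: measurableI. Qed.

(** [mu (B m j)] is bounded by the [h]-packings of [B m j], and the factor [c j] is absorbed by the
    weight [w]. Packings of the separated sets [B m j] unite into a weighted packing of [X], which
    [wpack_le_Pdelta] lifts to [E]. *)
Let sum_B_le n m : (forall j x, (j < n)%N -> L j x -> ~ L j.+1 x -> c j <= w x) ->
  (\sum_(j < n) (c j)%:E * mu (B m j) <= Pzero (max_metric dX dY) gh D E)%E.
Proof.
move=> cw; have [h0 _] := hh.
apply: le_ereal_inf_tmp => _ [delta /= delta0 <-].
have m0 : 0 < m.+1%:R^-1 :> R by rewrite invr_gt0.
(* [r <= delta] serves monotonicity in the fineness, [r < eta] serves [wpack_le_Pdelta], and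
   [r < m.+1%:R^-1] the separation; halving makes the last two strict. *)
pose r := Num.min delta (Num.min eta m.+1%:R^-1 / 2).
have em0 : 0 < Num.min eta m.+1%:R^-1 by rewrite lt_min eta0.
have rem : r < Num.min eta m.+1%:R^-1.
  rewrite /r gt_min; apply/orP; right.
  by rewrite ltr_pdivrMr// mulr_natr mulr2n ltrDl.
have r0 : 0 < r by rewrite lt_min delta0 divr_gt0.
have [reta rm] : r < eta /\ r < m.+1%:R^-1 by move: rem; rewrite lt_min => /andP[].
have wh0 (p : X * R) : 0 < p.2 -> 0 <= w p.1 * h p.2.
  by move=> p0; rewrite mulr_ge0// ltW// h0.
apply: (@le_trans _ _ (Pdelta (max_metric dX dY) gh D r E)); last first.
  by apply: le_wpack => //; rewrite ge_min lexx.
apply: (@le_trans _ _ (wpack dX D (fun p => (w p.1 * h p.2)%R) r setT)); last first.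
  exact: (@wpack_le_Pdelta _ _ _ dX dY D g h E mX hg hh (fun p => w p.1) r eta).
apply: (@le_trans _ _ (\sum_(j < n) wpack dX D (fun p => (w p.1 * h p.2)%R) r (B m j))%E).
  apply: lee_sum => j _.
  apply: (@le_trans _ _ ((c j)%:E * wpack dX D (fun p => h p.2) r (B m j))%E).
    apply: lee_wpmul2l; first by rewrite lee_fin.
    rewrite muE//; apply: le_trans (Pmeas_le_Pzero _ _ _ _) _.
    by apply: ereal_inf_lbound; exists r.
  apply: wpackZl_le => //.
  - by move=> p p0; rewrite ltW// h0.
  (* A point far from [L j.+1] is not in it, being at distance [0] from itself, so [cw] applies. *)
  - move=> p [Lj far_p] p0; rewrite ler_wpM2r// ?(ltW (h0 _ p0))//.
    apply: (cw j) => // /far_p; apply/negP; rewrite -ltNge.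
    by case: mX => _ [/(_ p.1 p.1)[_ ->]].
(* For [i < j] the set [B m j] lies in [L i.+1], from which [B m i] keeps its distance. *)
apply: wpack_sum_le => // i j x y ij [_ far_x] [Ly _].
by apply: lt_le_trans rm _; apply: far_x; exact: L_le Ly.
Qed.

Lemma sum_level_sets_le n :
  (forall j x, (j < n)%N -> L j x -> ~ L j.+1 x -> c j <= w x) ->
  (\sum_(j < n) (c j)%:E * mu (L j `\` L j.+1) <= Pzero (max_metric dX dY) gh D E)%E.
Proof.
move=> cw.
have Bcup j : \bigcup_m B m j = L j `\` L j.+1.
  apply/seteqP; split => x.
    move=> [m _ [Lx far_x]]; split => // /far_x; apply/negP; rewrite -ltNge.
    by case: mX => _ [/(_ x x)[_ ->]]// _; rewrite invr_gt0.
  (* As [L j.+1] is closed, a point outside it has a ball missing it, and so lies in [B m j] for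
     large [m]. *)
  move=> [Lx nLx]; have [e [e0 xe]] := openLC nLx.
  have [m _ me] := near_infty_natSinv_lt (PosNum e0).
  exists m => //; split => // y Ly; rewrite leNgt; apply/negP => xy.
  have /= := me m (leqnn m) => {}me.
  by apply: (xe y) => //=; exact: lt_trans me.
apply: (@cvge_le _ \oo _ _ (fun m => \sum_(j < n) (c j)%:E * mu (B m j))%E).
  by apply: nearW => m; exact: sum_B_le.
apply: cvg_nnesum => [j _|j _].
  by apply: nearW => m; rewrite mule_ge0// lee_fin.
apply: cvgeZl => //; rewrite -Bcup; apply: nondecreasing_cvg_mu => //.
  exact: bigcup_measurable.
move=> m k mk; apply/subsetPset => x [Lx far_x]; split => // y Ly.
apply: le_trans (far_x y Ly); rewrite lef_pV2 ?posrE// ler_nat ltnS.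
exact: mk.
Qed.

End level_sets.

Lemma integral_usc_envelope_le (E : set (X * Y)) (eta : R) : 0 < eta ->
  (\int[mu]_x (usc_envelope dX (lowerB_upto dY g E eta) : borel_metric dX -> \bar R) x
     <= Pzero (max_metric dX dY) gh D E)%E.
Proof.
move=> eta0; set phi : borel_metric dX -> \bar R := usc_envelope _ _.
have mphi : measurable_fun setT phi by exact: measurable_usc_envelope.
have phi0 x : (0 <= phi x)%E.
  by apply: le_trans (le_usc_envelope mX _ _); exact: lowerB_upto_ge0.
apply: integral_le_dyadic_level => // n.
(* The factor [t < 1] makes [t * approx < phi] strict wherever it is nonzero. *)
apply/lee_mul01Pr => [|t /andP[t0 t1]].
  by apply: sume_ge0 => k _; rewrite mule_ge0// lee_fin divr_ge0.
rewrite ge0_sume_distrr; last by move=> k _; rewrite mule_ge0// lee_fin divr_ge0.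
under eq_bigr do rewrite muleA -EFinM.
have app0 x : 0 <= approx setT phi n x by rewrite approx_dyadic_level// sumr_ge0.
apply: (@sum_level_sets_le E eta (fun x => t * approx setT phi n x)
  (fun k => t * (k%:R / 2 ^+ n)) (dyadic_level phi n)) => //.
- by move=> x; rewrite mulr_ge0// ltW.
- move=> x; have [->|an0] := eqVneq (approx setT phi n x) 0; first by left; rewrite mulr0.
  right; apply: (@lt_le_trans _ _ (approx setT phi n x)%:E); last exact: le_approx.
  by rewrite lte_fin gtr_pMl// lt_def an0 app0.
- by move=> j; rewrite mulr_ge0// ltW.
- by move=> j; exact: measurable_dyadic_level.
- move=> j; rewrite /dyadic_level; case: ifP => _; last first.
    by move=> x _; exists 1; split => //= y _.
  rewrite (_ : ~` _ = [set x | (phi x < (j%:R / 2 ^+ n)%:E)%E]).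
    exact: metric_open_usc_envelope.
  by apply/seteqP; split => x /=; rewrite ltNge => /negP.
- by move=> j; exact: dyadic_level_decr.
(* The [j]-th term of [approx] already equals [j%:R / 2 ^+ n] at [x]; the other terms are
   nonnegative. *)
- move=> j x jn Lx nLx; rewrite ler_pM2l// approx_dyadic_level//.
  by rewrite (bigD1 (Ordinal jn))//= indicE mem_set// mulr1 lerDl sumr_ge0.
Qed.

(** [lowerB_upto] grows as [eta] decreases, so the supremum over [eta] may be taken along
    [n.+1%:R^-1], where [majorized_sup] applies with the envelopes as majorants. *)
Lemma majorized_lowerB0 (E : set (X * Y)) :
  majorized mu (fun x : borel_metric dX => lowerB0 dY g (xsection E x))
    (Pzero (max_metric dX dY) gh D E).
Proof.
pose f n (x : borel_metric dX) := lowerB_upto dY g E n.+1%:R^-1 x.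
apply: (@le_majorized _ _ _ mu _ (fun x => ereal_sup [set f n x | n in setT]) _ _ _ (lexx _)).
  move=> x; apply: ge_ereal_sup => _ [eta eta0 <-].
  have [n _ ne] := near_infty_natSinv_lt (PosNum eta0).
  apply: le_trans (ereal_sup_ubound _); last by exists n.
  apply: ereal_inf_le_tmp => _ [r /= /andP[r0 rn] <-]; exists r => //=.
  by rewrite r0 (lt_trans rn)//; exact: (ne n (leqnn n)).
apply: majorized_sup.
- by move=> n x; exact: lowerB_upto_ge0.
- move=> n m x nm; apply: ereal_inf_le_tmp => _ [r /= /andP[r0 rm] <-]; exists r => //=.
  by rewrite r0 (lt_le_trans rm)// lef_pV2 ?posrE// ler_nat ltnS.
- move=> n; exists (usc_envelope dX (lowerB_upto dY g E n.+1%:R^-1)); split.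
  + exact: measurable_usc_envelope.
  + by move=> x; exact: le_usc_envelope.
  + by apply: integral_usc_envelope_le; rewrite invr_gt0.
Qed.

Lemma le_lowerB0 (F G : set Y) : F `<=` G -> (lowerB0 dY g F <= lowerB0 dY g G)%E.
Proof.
move=> FG; apply: ge_ereal_sup => _ [eta eta0 <-].
apply: le_trans (ereal_sup_ubound _); last by exists eta.
apply: le_ereal_inf_tmp => _ [r /andP[r0 rn] <-].
apply: le_trans (ereal_inf_lbound _) _; first by exists r; rewrite //= r0.
apply: lee_wpmul2r; last exact: le_Cdelta.
by rewrite lee_fin ltW//; case: hg => + _; exact.
Qed.

Lemma lowerB0_ge0 (F : set Y) : (0 <= lowerB0 dY g F)%E.
Proof.
apply: le_trans (ereal_sup_ubound _); last by exists 1 => //=.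
apply: le_ereal_inf_tmp => _ [r /andP[r0 _] <-].
by rewrite mule_ge0 ?Cdelta_ge0// lee_fin ltW//; case: hg => + _; exact.
Qed.

Lemma majorized_vecB (E : set (X * Y)) (F : nat -> set (X * Y)) :
  E `<=` \bigcup_n F n ->
  majorized mu (fun x : borel_metric dX => vecB dY g (xsection E x))
    (\sum_(0 <= n <oo) Pzero (max_metric dX dY) gh D (F n))%E.
Proof.
move=> EF.
have gh0 r : 0 < r -> 0 <= gh r.
  by case: hg hh => g0 _ [h0 _] r0; rewrite mulr_ge0 ?ltW ?g0 ?h0.
(* The parts of [E] covered by the first [n] sets increase to [E], so their sections are admissible
   in [vecB], and [Pzero] of [G n] is at most a partial sum of the series. *)
pose G n : set (X * Y) := E `&` [set p | exists2 i, (i < n)%N & F i p].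
have GS n m : (n <= m)%N -> G n `<=` G m.
  by move=> nm p [Ep [i ni Fp]]; split => //; exists i => //; exact: leq_trans nm.
have xG n m x : (n <= m)%N -> xsection (G n) x `<=` xsection (G m) x.
  by move=> nm y; rewrite /xsection/= !in_setE; exact: GS.
apply: (@le_majorized _ _ _ mu _
  (fun x => ereal_sup [set lowerB0 dY g (xsection (G n) x) | n in setT]) _ _ _ (lexx _)).
  move=> x; apply: ereal_inf_lbound; exists (fun n => xsection (G n) x) => //.
  split; first by move=> n; exact: xG.
  apply/seteqP; split => y; rewrite /xsection/= ?in_setE.
    by move=> [n _]; rewrite /= !in_setE => -[].
  move=> Exy; have [i _ Fi] := EF _ Exy; exists i.+1 => //=; rewrite in_setE.
  by split => //; exists i.
apply: majorized_sup.
- by move=> n x; exact: lowerB0_ge0.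
- by move=> n m x nm; apply: le_lowerB0; exact: xG.
- move=> n; apply: le_majorized (majorized_lowerB0 (G n)) => //.
  apply: le_trans (nneseries_lim_ge n _); last by move=> k _ _; exact: Pzero_ge0.
  apply: le_trans (Pzero_bigcup_lt _ _ gh0 _ _).
  by apply: le_Pzero => p [].
Qed.

End upper_integral_product.

Theorem theorem3p4 (R : realType) (X : pointedType) (Y : choiceType)
    (dX : X -> X -> R) (dY : Y -> Y -> R) (D : set R) (g h : R -> R)
    (E : set (X * Y)) (mu : {measure set (borel_metric dX) -> \bar R}) :
  is_metric dX -> is_metric dY -> scale D -> hausdorff_fun g -> hausdorff_fun h ->
  (forall A : set (borel_metric dX), measurable A -> mu A = Pmeas dX h D A) ->
  (upper_integral mu (fun x : borel_metric dX => vecB dY g (xsection E x))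
     <= Pmeas (max_metric dX dY) (fun r => (g r * h r)%R) D E)%E.
Proof.
move=> mX _ _ hg hh muE; apply: le_ereal_inf_tmp => _ [F EF <-].
by apply: upper_integral_le; exact: (majorized_vecB dY mX hg hh muE EF).
Qed.
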